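(* Let $n$ be odd. Every Poncelet $n$-gon in $\mathbb{CP}^2$ is $n$-self-dual.
   Context: $V=\mathbb C^3$, $P=\mathbb{CP}^2$ is its projectivization, $P^*$ is the projectivization of $V^*$; for a line $B$ of $P$, $B^*\in P^*$ denotes its annihilator in $V^*$. An $n$-gon in $P$ is a cyclically ordered collection of vertices $A_1,A_3,\dots,A_{2n-1}\in P$ (indices are odd residues modulo $2n$) and sides $B_{2i}=A_{2i-1}A_{2i+1}$ (indices are even residues modulo $2n$). Polygons are non-degenerate: no three consecutive vertices are collinear. For $n$ odd, an $n$-gon is $n$-self-dual if there is a projective isomorphism $g\colon P\to P^*$ with $g(A_i)=B_{i+n}^*$ for all $i$ (i.e. every vertex goes to the point dual to the opposite side). An $n$-gon with odd $n$ is a Poncelet polygon if it is both inscribed into a non-degenerate conic (all vertices lie on it) and circumscribed about a non-degenerate conic (all sides are tangent to it). *)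

(* Defs.v *)
From HB Require Import structures.
From mathcomp Require Import all_boot all_order all_algebra.
From mathcomp Require Import complex.
From mathcomp Require Import reals.

Set Implicit Arguments.
Unset Strict Implicit.
Unset Printing Implicit Defensive.

Import GRing.Theory.
Local Open Scope ring_scope.

Section Projective.

Variable K : fieldType.

(* The points of the projectivization are the lines through the origin; since
   equality of {vspace V} is equality of subspaces, = on proj V is equality of
   projective points. *)
Record proj (V : vectType K) : Type := Proj {
  proj_space :> {vspace V};
  proj_dim : \dim proj_space = 1%N }.

Definition is_line (V : vectType K) (L : {vspace V}) : Prop := \dim L = 2%N.

Definition collinear (V : vectType K) (p q r : proj V) : Prop :=
  exists2 L : {vspace V}, is_line L & [/\ (p <= L)%VS, (q <= L)%VS & (r <= L)%VS].

Definition join (V : vectType K) (p q : proj V) : {vspace V} := (p + q)%VS.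

Definition is_proj_iso (U W : vectType K) (g : proj U -> proj W) : Prop :=
  exists f : 'Hom(U, W), [/\ lker f = 0%VS, limg f = fullv
    & forall p : proj U, g p = (f @: p)%VS :> {vspace W}].

Definition dual (V : vectType K) : vectType K := 'Hom(V, K^o).

Section Annihilator.

Variables (V : vectType K) (U : {vspace V}).

Definition restrict_form (f : dual V) : dual V := (f \o projv U)%VF.

Fact restrict_form_is_linear : linear restrict_form.
Proof. by move=> a f h; rewrite /restrict_form comp_lfunDl comp_lfunZl. Qed.

HB.instance Definition _ := GRing.isLinear.Build K (dual V) (dual V) _
  restrict_form restrict_form_is_linear.

Definition annihilator : {vspace dual V} := lker (linfun restrict_form).

Lemma mem_annihilatorP (f : dual V) :
  reflect (forall v, v \in U -> f v = 0) (f \in annihilator).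
Proof.
rewrite memv_ker lfunE /=; apply: (iffP eqP) => [f0 v Uv | f0].
  by rewrite -(projv_id Uv) -[LHS](comp_lfunE f (projv U)) [(f \o _)%VF]f0 lfunE.
apply/lfunP=> v; rewrite comp_lfunE zero_lfunE; apply: f0.
exact: memv_proj.
Qed.

End Annihilator.

(* The conic with symmetric matrix Q is the zero locus of v Q v^T. *)
Definition nondegenerate_conic (Q : 'M[K]_3) : Prop :=
  Q^T = Q /\ \det Q != 0.

Definition on_conic (Q : 'M[K]_3) (p : proj 'rV[K]_3) : Prop :=
  forall v : 'rV[K]_3, v \in (p : {vspace _}) -> v *m Q *m v^T = 0.

(* The differential of v Q v^T at v is w |-> 2 v Q w^T, so the tangent line at
   a point p of the conic consists of the w with v Q w^T = 0 for v in p. *)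
Definition tangent_at (Q : 'M[K]_3) (p : proj 'rV[K]_3)
    (L : {vspace 'rV[K]_3}) : Prop :=
  on_conic Q p /\
  forall w : 'rV[K]_3, w \in L <->
    (forall v : 'rV[K]_3, v \in (p : {vspace _}) -> v *m Q *m w^T = 0).

Definition tangent (Q : 'M[K]_3) (L : {vspace 'rV[K]_3}) : Prop :=
  is_line L /\ exists p : proj 'rV[K]_3, tangent_at Q p L.

End Projective.

Arguments dual {K} V.

Section Polygons.

Variables (R : realType) (n : nat).

(* Indices are residues modulo 2n.  Vertices carry odd indices and sides carry
   even ones; the values of a polygon at even indices are never used.  For n
   odd, 2n > 1, so 'Z_(n.*2) is the ring of residues modulo 2n. *)
Definition polygon : Type := 'Z_(n.*2) -> proj 'rV[R[i]]_3.

Implicit Types (A : polygon) (i j : 'Z_(n.*2)).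

Definition side A j : {vspace 'rV[R[i]]_3} := join (A (j - 1)) (A (j + 1)).

Definition nondegenerate_polygon A : Prop :=
  forall i, odd i -> ~ collinear (A (i - 2%:R)) (A i) (A (i + 2%:R)).

Definition inscribed A (Q : 'M[R[i]]_3) : Prop :=
  forall i, odd i -> on_conic Q (A i).

Definition circumscribed A (Q : 'M[R[i]]_3) : Prop :=
  forall j, ~~ odd j -> tangent Q (side A j).

Definition poncelet A : Prop :=
  (exists2 Q, nondegenerate_conic Q & inscribed A Q) /\
  (exists2 Q, nondegenerate_conic Q & circumscribed A Q).

Definition n_self_dual A : Prop :=
  exists2 g : proj 'rV[R[i]]_3 -> proj (dual 'rV[R[i]]_3), is_proj_iso g &
    forall i, odd i -> g (A i) = annihilator (side A (i + n%:R)) :> {vspace _}.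

End Polygons.

(* Main.v *)
Require Import Defs.
From HB Require Import structures.
From mathcomp Require Import all_boot all_order all_algebra.
From mathcomp Require Import complex.
From mathcomp Require Import boolp reals.
From mathcomp Require Import ring zify.

(** Let [P] be the matrix of the conic touched by the sides, [Q] that of the
    conic through the vertices, and [n = 2m + 1].  The vertices can be rescaled
    to vectors [u k] with [P(u k, u k) = p] constant and [u k + u (k + 1)] a
    multiple of the point of tangency of the side joining them; using the tangency points
    to fix the signs makes [u] periodic of period [n], since [n] is odd.  Now
    [u] moves on the curve [P = p, Q = 0] along the two rulings of the quadric
    [P = p] in turn, and [(p + P(u i, u (i + m))) / Q(u i, u (i + m))] does not
    depend on [i]: all the lines [A_i A_(i + 2m)] touch one conic [M] of the
    pencil of [P] and [Q].  The symmetric form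
    [G = 2 Q adj(M) Q - tr(adj(M) Q) Q] vanishes at two points of [Q] whose
    join touches [M], so [G] takes a vertex to the line through its images
    under [m] steps in both directions, which is the opposite side. *)

Set Implicit Arguments.
Unset Strict Implicit.
Unset Printing Implicit Defensive.

Import GRing.Theory.
Local Open Scope ring_scope.

Local Notation o0 := (@ord0 2).
Local Notation o1 := (lift (@ord0 2) (@ord0 1)).
Local Notation o2 := (lift (@ord0 2) (lift (@ord0 1) (@ord0 0))).

(** * Bilinear forms, cross products and adjugates in dimension three *)

Section Space.
Variable F : fieldType.
Implicit Types (a b c d e f u v w x y z : 'rV[F]_3) (M N P Q : 'M[F]_3).

Lemma ord3P (T : 'I_3 -> Prop) : T o0 -> T o1 -> T o2 -> forall i, T i.
Proof.
move=> t0 t1 t2 i; case: (unliftP o0 i) => [j ->|-> //].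
case: (unliftP (@ord0 1) j) => [k ->|-> //].
by rewrite (ord1 k).
Qed.

Lemma sum3 (E : 'I_3 -> F) : \sum_i E i = E o0 + E o1 + E o2.
Proof. by rewrite !big_ord_recl big_ord0 addr0 addrA. Qed.

Lemma row3P x y : x 0 o0 = y 0 o0 -> x 0 o1 = y 0 o1 -> x 0 o2 = y 0 o2 -> x = y.
Proof. by move=> ? ? ?; apply/rowP; apply: ord3P. Qed.

Definition bil M x y : F := (x *m M *m y^T) 0 0.

Definition cross a b : 'rV[F]_3 := \row_j nth 0
  [:: a 0 o1 * b 0 o2 - a 0 o2 * b 0 o1;
      a 0 o2 * b 0 o0 - a 0 o0 * b 0 o2;
      a 0 o0 * b 0 o1 - a 0 o1 * b 0 o0] j.

Definition triple a b c : F := bil 1%:M (cross a b) c.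

Lemma bilE M x y : bil M x y =
  (x 0 o0 * M o0 o0 + x 0 o1 * M o1 o0 + x 0 o2 * M o2 o0) * y 0 o0 +
  (x 0 o0 * M o0 o1 + x 0 o1 * M o1 o1 + x 0 o2 * M o2 o1) * y 0 o1 +
  (x 0 o0 * M o0 o2 + x 0 o1 * M o1 o2 + x 0 o2 * M o2 o2) * y 0 o2.
Proof. by rewrite /bil !mxE sum3 !mxE !sum3. Qed.

Lemma tripleE a b c : triple a b c =
  (a 0 o1 * b 0 o2 - a 0 o2 * b 0 o1) * c 0 o0 +
  (a 0 o2 * b 0 o0 - a 0 o0 * b 0 o2) * c 0 o1 +
  (a 0 o0 * b 0 o1 - a 0 o1 * b 0 o0) * c 0 o2.
Proof. by rewrite /triple /bil mulmx1 !mxE sum3 !mxE. Qed.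

Lemma bilDl M x y z : bil M (x + y) z = bil M x z + bil M y z.
Proof. by rewrite /bil !mulmxDl mxE. Qed.
Lemma bilDr M x y z : bil M z (x + y) = bil M z x + bil M z y.
Proof. by rewrite /bil linearD mulmxDr mxE. Qed.
Lemma bilZl M k x z : bil M (k *: x) z = k * bil M x z.
Proof. by rewrite /bil -!scalemxAl mxE. Qed.
Lemma bilZr M k x z : bil M z (k *: x) = k * bil M z x.
Proof. by rewrite /bil linearZ -scalemxAr mxE. Qed.
Lemma bilNl M x z : bil M (- x) z = - bil M x z.
Proof. by rewrite /bil !mulNmx mxE. Qed.
Lemma bilNr M x z : bil M z (- x) = - bil M z x.
Proof. by rewrite /bil linearN mulmxN mxE. Qed.
Lemma bil0l M x : bil M 0 x = 0.
Proof. by rewrite /bil !mul0mx mxE. Qed.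
Definition bil_lin := (bilDl, bilDr, bilNl, bilNr, bilZl, bilZr).

Lemma bilC M x y : M^T = M -> bil M x y = bil M y x.
Proof.
move=> sM; rewrite /bil.
have -> : x *m M *m y^T = (y *m M *m x^T)^T by rewrite !trmx_mul trmxK sM mulmxA.
by rewrite mxE.
Qed.

Lemma tripleDl a b c x : triple (a + b) c x = triple a c x + triple b c x.
Proof. by rewrite !tripleE !mxE; ring. Qed.
Lemma tripleNl a c x : triple (- a) c x = - triple a c x.
Proof. by rewrite !tripleE !mxE; ring. Qed.
Lemma triple_rot a b c : triple a b c = triple b c a.
Proof. by rewrite !tripleE; ring. Qed.
Lemma tripleZm k a c x : triple a (k *: c) x = k * triple a c x.
Proof. by rewrite !tripleE !mxE; ring. Qed.

Lemma cramer a b c x :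
  triple a b c *: x = triple x b c *: a + triple a x c *: b + triple a b x *: c.
Proof. by apply: row3P; rewrite !tripleE !mxE; ring. Qed.

Lemma det33 M : \det M =
  M o0 o0 * (M o1 o1 * M o2 o2 - M o1 o2 * M o2 o1)
  - M o0 o1 * (M o1 o0 * M o2 o2 - M o1 o2 * M o2 o0)
  + M o0 o2 * (M o1 o0 * M o2 o1 - M o1 o1 * M o2 o0).
Proof.
have e1 : lift o1 (@ord0 1) = o0 by apply: val_inj.
have e2 : lift o1 (lift (@ord0 1) (@ord0 0)) = o2 by apply: val_inj.
have e3 : lift o2 (@ord0 1) = o0 by apply: val_inj.
have e4 : lift o2 (lift (@ord0 1) (@ord0 0)) = o1 by apply: val_inj.
have e5 : lift (lift (@ord0 1) (@ord0 0)) (@ord0 0) = @ord0 1 by apply: val_inj.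
rewrite (expand_det_row _ o0) sum3 /cofactor !(expand_det_row _ (@ord0 1)) !big_ord_recl !big_ord0.
rewrite /cofactor !det_mx11 !mxE /= ?(e1,e2,e3,e4,e5).
rewrite /bump /= !(exprS,expr0).
ring.
Qed.

Lemma det22 (M : 'M[F]_2) : \det M = M 0 0 * M (lift (@ord0 1) (@ord0 0)) (lift (@ord0 1) (@ord0 0))
  - M 0 (lift (@ord0 1) (@ord0 0)) * M (lift (@ord0 1) (@ord0 0)) 0.
Proof.
have e5 : lift (lift (@ord0 1) (@ord0 0)) (@ord0 0) = @ord0 1 by apply: val_inj.
rewrite (expand_det_row _ (@ord0 1)) !big_ord_recl !big_ord0.
rewrite /cofactor !det_mx11 !mxE /= ?e5 /bump /= !(exprS,expr0).
ring.
Qed.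

(** Shifting the indices cyclically absorbs the signs of the cofactors. *)
Lemma adj_cofactor M i j : \adj M i j =
  M (ordS j) (ordS i) * M (ordS (ordS j)) (ordS (ordS i))
  - M (ordS j) (ordS (ordS i)) * M (ordS (ordS j)) (ordS i).
Proof.
have e1 : lift o1 (@ord0 1) = o0 by apply: val_inj.
have e2 : lift o1 (lift (@ord0 1) (@ord0 0)) = o2 by apply: val_inj.
have e3 : lift o2 (@ord0 1) = o0 by apply: val_inj.
have e4 : lift o2 (lift (@ord0 1) (@ord0 0)) = o1 by apply: val_inj.
have s0 : ordS o0 = o1 by apply: val_inj.
have s1 : ordS o1 = o2 by apply: val_inj.
have s2 : ordS o2 = o0 by apply: val_inj.
rewrite mxE; move: i j; apply: ord3P; apply: ord3P.
all: rewrite /cofactor det22 !mxE ?(e1,e2,e3,e4,s0,s1,s2) /= /bump /= !(exprS,expr0).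
all: ring.
Qed.

Lemma adjE M : let A := \adj M in
 ((A o0 o0 = M o1 o1 * M o2 o2 - M o1 o2 * M o2 o1) *
 (A o0 o1 = M o2 o1 * M o0 o2 - M o2 o2 * M o0 o1) *
 (A o0 o2 = M o0 o1 * M o1 o2 - M o0 o2 * M o1 o1) *
 (A o1 o0 = M o1 o2 * M o2 o0 - M o1 o0 * M o2 o2) *
 (A o1 o1 = M o2 o2 * M o0 o0 - M o2 o0 * M o0 o2) *
 (A o1 o2 = M o0 o2 * M o1 o0 - M o0 o0 * M o1 o2) *
 (A o2 o0 = M o1 o0 * M o2 o1 - M o1 o1 * M o2 o0) *
 (A o2 o1 = M o2 o0 * M o0 o1 - M o2 o1 * M o0 o0) *
 (A o2 o2 = M o0 o0 * M o1 o1 - M o0 o1 * M o1 o0))%type.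
Proof.
have s0 : ordS o0 = o1 by apply: val_inj.
have s1 : ordS o1 = o2 by apply: val_inj.
have s2 : ordS o2 = o0 by apply: val_inj.
by rewrite /= !adj_cofactor ?(s0,s1,s2).
Qed.

(** Up to transposition, [\adj M] is the action of [M] on bivectors, so this is a Cauchy-Binet
    formula. *)
Lemma bil_adj M a b c d :
  bil (\adj M) (cross c d) (cross a b) = bil M a c * bil M b d - bil M a d * bil M b c.
Proof. rewrite !bilE !adjE !mxE /=; ring. Qed.

(** The left side expands the determinant of the Gram matrix [U P U^T], where [U] has rows [a], [b],
    [c] and determinant [triple a b c]. *)
Lemma gram P a b c :
  bil P a a * (bil P b b * bil P c c - bil P b c * bil P c b)
  - bil P a b * (bil P b a * bil P c c - bil P b c * bil P c a)
  + bil P a c * (bil P b a * bil P c b - bil P b b * bil P c a)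
  = \det P * triple a b c ^+ 2.
Proof. by rewrite det33 !bilE tripleE; ring. Qed.
(** Reduces a goal that follows linearly from a known equation to a ring identity with explicit
    cofactor [r]. *)
Lemma lincomb1 (r s t x y : F) : s = t -> x - y = r * (s - t) -> x = y.
Proof. by move=> ->; rewrite subrr mulr0 => /subr0_eq. Qed.

Lemma lincomb2 (q r s t s' t' x y : F) : s = t -> s' = t' ->
  x - y = q * (s - t) + r * (s' - t') -> x = y.
Proof. by move=> -> ->; rewrite !subrr !mulr0 addr0 => /subr0_eq. Qed.

Lemma sym_entries M : M^T = M ->
  ((M o1 o0 = M o0 o1) * (M o2 o0 = M o0 o2) * (M o2 o1 = M o1 o2))%type.
Proof. by move=> sM; rewrite -{1 3 5}sM !mxE. Qed.

Lemma trace_prod M N : \tr (M *m N) = \sum_i \sum_j M i j * N j i.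
Proof. by apply: eq_bigr => i _; rewrite mxE. Qed.

(** For the inverse form of [Q], [cross u v] is orthogonal to [u *m Q] and [v *m Q]. The trace of
    [N] relative to [Q] therefore splits into a part on their span and a part on [cross u v]; the
    identity is this splitting times the Gram determinant of [u], [v]. *)
Lemma gram_form Q N u v : Q^T = Q ->
  \tr (N *m Q) * (bil Q u u * bil Q v v - bil Q u v ^+ 2)
  + bil Q u v * (bil N (u *m Q) (v *m Q) + bil N (v *m Q) (u *m Q))
  - bil Q v v * bil N (u *m Q) (u *m Q) - bil Q u u * bil N (v *m Q) (v *m Q)
  = \det Q * bil N (cross u v) (cross u v).
Proof.
move=> /sym_entries sQ; rewrite trace_prod !sum3 !bilE det33 !mxE !sum3 /= !sQ.
ring.
Qed.

Lemma bil0r M x : bil M x 0 = 0.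
Proof. by rewrite /bil trmx0 mulmx0 mxE. Qed.

Lemma bil_mulmx M x y N : bil N (x *m M) y = bil (M *m N) x y.
Proof. by rewrite /bil mulmxA. Qed.

Lemma bil_eq0 M x : (forall y, bil M x y = 0) -> x *m M = 0.
Proof.
move=> h; apply/rowP => j; move: (h (delta_mx 0 j)); rewrite /bil.
by rewrite trmx_delta -colE !mxE.
Qed.

Lemma nondeg_eq0 M x : \det M != 0 -> x *m M = 0 -> x = 0.
Proof.
move=> dM h; have uM : M \in unitmx by rewrite unitmxE unitfE.
by rewrite -(mulmxK uM x) h mul0mx.
Qed.

Lemma cross_eq0 a b : (forall x, triple a b x = 0) -> cross a b = 0.
Proof. by move=> /(@bil_eq0 1%:M); rewrite mulmx1. Qed.

Lemma row3_neq0 b : b != 0 -> exists j, b 0 j != 0.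
Proof.
move=> nb; case: (pickP (fun j => b 0 j != 0)) => [j ?|h]; first by exists j.
by case/eqP: nb; apply/rowP => j; move/negbFE/eqP: (h j) => ->; rewrite mxE.
Qed.

Lemma cross_eq0_scale a b : cross a b = 0 -> b != 0 -> exists k, a = k *: b.
Proof.
move=> ab /row3_neq0 [j bj]; exists (a 0 j / b 0 j).
suff {bj} h : b 0 j *: a = a 0 j *: b.
  by rewrite mulrC -scalerA -h scalerA mulVf // scale1r.
move: (congr1 (fun z : 'rV_3 => z 0 o0) ab) (congr1 (fun z : 'rV_3 => z 0 o1) ab)
 (congr1 (fun z : 'rV_3 => z 0 o2) ab); rewrite !mxE /= => /eqP + /eqP + /eqP.
rewrite !subr_eq0 => /eqP h0 /eqP h1 /eqP h2.
by move: j; apply: ord3P; apply: row3P; rewrite !mxE;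
  first [ring | apply: (lincomb1 (r := 1) h0); ring | apply: (lincomb1 (r := 1) h1); ring
   | apply: (lincomb1 (r := 1) h2); ring | apply: (lincomb1 (r := -1) h0); ring
   | apply: (lincomb1 (r := -1) h1); ring | apply: (lincomb1 (r := -1) h2); ring].
Qed.

Lemma perp_cross a b w : bil 1%:M w a = 0 -> bil 1%:M w b = 0 -> cross a b != 0 ->
  exists k, w = k *: cross a b.
Proof.
move=> wa wb nz; apply: cross_eq0_scale nz.
have -> : cross w (cross a b) = bil 1%:M w b *: a - bil 1%:M w a *: b.
  by rewrite /bil !mulmx1; apply: row3P; rewrite !mxE !sum3 !mxE /=; ring.
by rewrite wa wb !scale0r subr0.
Qed.

Lemma bil1_mul M w x : bil 1%:M (w *m M) x = bil M w x.
Proof. by rewrite bil_mulmx mulmx1. Qed.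

Lemma cross0l a : cross 0 a = 0.
Proof. by apply: row3P; rewrite !mxE /=; ring. Qed.
Lemma cross_neq0l a b : cross a b != 0 -> a != 0.
Proof. by apply: contraNneq => ->; rewrite cross0l. Qed.

(** A smooth conic contains no line: for independent [a] and [b], both [a *m M] and [b *m M] would
    be multiples of [cross a b], so a nonzero combination of [a] and [b] would be in the kernel of
    [M]. *)
Lemma isotropic M a b : M^T = M -> \det M != 0 ->
  bil M a a = 0 -> bil M a b = 0 -> bil M b b = 0 -> cross a b = 0.
Proof.
move=> sM dM aa ab bb; apply/eqP; apply/negPn/negP => nz.
have [||//|k ak] := @perp_cross a b (a *m M); rewrite ?bil1_mul //.
have ba : bil M b a = 0 by rewrite bilC.
have [||//|l bl] := @perp_cross a b (b *m M); rewrite ?bil1_mul //.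
have h : l *: a - k *: b = 0.
  by apply: (nondeg_eq0 dM); rewrite mulmxBl -!scalemxAl ak bl !scalerA mulrC subrr.
have [k0|k0] := eqVneq k 0.
  case/eqP: (cross_neq0l nz); apply: (nondeg_eq0 dM); by rewrite ak k0 scale0r.
have bE : b = (l / k) *: a.
  by rewrite mulrC -scalerA (subr0_eq h) scalerA mulVf // scale1r.
case/eqP: nz; rewrite bE; apply: row3P; rewrite !mxE /=; ring.
Qed.

End Space.

(** * Poncelet steps *)

Section Step.
Variable F : fieldType.
Implicit Types a b c d : 'rV[F]_3.
Variables (P Q : 'M[F]_3) (p : F).
Hypotheses (sP : P^T = P) (sQ : Q^T = Q) (dP : \det P != 0) (dQ : \det Q != 0).
Hypotheses (p0 : p != 0) (two : 2%:R != 0 :> F).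

Definition on_curve a : Prop := bil P a a = p /\ bil Q a a = 0.

(* The last condition says that [a + b] is isotropic and orthogonal to [a], and
   selects one of the two isotropic lines in the orthogonal of [a]: the other
   one has [p] in place of [- p].  Thus [b] is a function of [a]. *)
Definition step a b : Prop := [/\ on_curve a, on_curve b, a + b != 0 &
  forall x, triple a (a + b) x = - p * bil P (a + b) x].

Lemma curve_neq0 a : on_curve a -> a != 0.
Proof. by case=> + _; apply: contra_eq_neq => ->; rewrite bil0l eq_sym. Qed.

Lemma curveN a : on_curve a -> on_curve (- a).
Proof. by case=> pa qa; split; rewrite bilNl bilNr opprK. Qed.

(** At [x = a + b] the triple product in the orientation condition vanishes, leaving
    [2 p (p + P(a, b)) = 0]. *)
Lemma stepP a b : step a b ->
  [/\ bil P a b = - p, bil P a (a + b) = 0 & bil P (a + b) (a + b) = 0].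
Proof.
case=> -[pa _] [pb _] _ h; move: (h (a + b)) (h a).
rewrite !bilDr !bilDl (bilC b a) // pa pb tripleE !mxE.
set s := bil P a b.
have -> : p + s + (s + p) = 2%:R * (p + s) by ring.
move=> e1 _; have : p * 2%:R * (p + s) = 0.
  by apply/eqP; rewrite -oppr_eq0 -mulrA -mulNr -e1; apply/eqP; ring.
move/eqP; rewrite !mulf_eq0 (negPf p0) (negPf two) /= addrC addr_eq0 => /eqP ->.
by split => //; ring.
Qed.

Lemma stepN a b : step a b -> step (- b) (- a).
Proof.
case=> ca cb nz h; split; try exact: curveN.
  by rewrite -opprD oppr_eq0 addrC.
move=> x; move: (h x); rewrite -opprD (addrC b a) bilNl !tripleE ?mxE => e.
by apply: (lincomb1 (r := -1) e); ring.
Qed.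

(** If [Q(a, a + b)] vanished, [a] would be a multiple of [a + b], which is P-orthogonal to [a],
    against [P(a, a) = p]. *)
Lemma step_quad a b : step a b -> bil Q (a + b) (a + b) = 2%:R * bil Q a (a + b)
   /\ bil Q a (a + b) != 0.
Proof.
move=> st; have [pab pae pee] := stepP st; case: st => -[pa qa] [pb qb] nz h.
have qab : bil Q (a + b) (a + b) = 2%:R * bil Q a (a + b).
  by rewrite !bilDr !bilDl (bilC b a) // qa qb; ring.
split=> //; apply/negP => /eqP q0.
have := isotropic sQ dQ qa q0; rewrite qab q0 mulr0 => /(_ erefl) /cross_eq0_scale /(_ nz) [k ak].
by move: p0; rewrite -pa {1}ak bilZl bilC // pae mulr0 eqxx.
Qed.

(** Evaluating each orientation condition at the other sum and using antisymmetry gives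
    [P(a + b, a + c) = 0]. Hence [a + c = k (a + b)], and [Q] forces [k = 1]. *)
Lemma step_uniq a b c : step a b -> step a c -> b = c.
Proof.
move=> sb sc; have [_ pae pee] := stepP sb; have [_ paf pff] := stepP sc.
have [qe qae] := step_quad sb; have [qf qaf] := step_quad sc.
case: sb => _ _ nze he; case: sc => _ _ nzf hf.
set e := a + b in pae pee qe qae nze he *; set f := a + c in paf pff qf qaf nzf hf *.
have eE : e = a + b by []. have fE : f = a + c by []. clearbody e f.
have : 2%:R * p * bil P e f = 0.
  move: (he f) (hf e); rewrite (bilC f e) // !tripleE ?mxE => h1 h2.
  apply: (lincomb2 (q := 1) (r := 1) h1 h2); ring.
move/eqP; rewrite !mulf_eq0 (negPf p0) (negPf two) /= => /eqP ef.
have fe : bil P f e = 0 by rewrite bilC.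
have [k fk] := cross_eq0_scale (isotropic sP dP pff fe pee) nze.
have k0 : k != 0 by apply: contraNneq nzf => k0; rewrite fk k0 scale0r.
have : 2%:R * k * (k - 1) * bil Q a e = 0.
  move: qf; rewrite fk !bil_lin qe => h; by apply: (lincomb1 (r := 1) h); ring.
move/eqP; rewrite !mulf_eq0 (negPf k0) (negPf two) (negPf qae) subr_eq0 orbF /=.
by move/eqP=> k1; move: fk; rewrite k1 scale1r fE eE => /addrI ->.
Qed.

(* Generically [e = a + b] and [f = c + d] are not P-orthogonal, and then the
   orientation in [step] forces [c = t e + s f - a], with
   [p + P(a, c) = s t P(e, f)] and [p + P(b, d) = (1 - s) (1 - t) P(e, f)].
   Otherwise [e] and [f] span the same tangent of P, and [c] is [a] or [- b]. *)
Lemma transport a b c d : step a b -> step c d ->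
  (p + bil P a c) * bil Q b d = (p + bil P b d) * bil Q a c.
Proof.
move=> sb sd; have [_ pae pee] := stepP sb; have [_ pcf pff] := stepP sd.
have [qe qae] := step_quad sb; have [qf qcf] := step_quad sd.
have be : b = (a + b) - a by rewrite addrAC subrr add0r.
have df : d = (c + d) - c by rewrite addrAC subrr add0r.
case: sb => -[pa qa] [pb qb] nze he; case: sd => -[pc qc] [pd qd] nzf hf.
rewrite be df in qb pb qd pd *.
set e := a + b in pae pee qe qae nze he qb pb be *.
set f := c + d in pcf pff qf qcf nzf hf qd pd df *.
clearbody e f.
have [h0|h0] := eqVneq (bil P e f) 0.
  have fe : bil P f e = 0 by rewrite bilC.
  have [k fk] := cross_eq0_scale (isotropic sP dP pff fe pee) nze.
  have k0 : k != 0 by apply: contraNneq nzf => k0; rewrite fk k0 scale0r.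
  have : cross (c - a) e = 0.
    apply: cross_eq0 => x; rewrite tripleDl tripleNl he.
    apply: (mulfI k0); rewrite mulr0 mulrBr -tripleZm -fk hf fk bilZl; ring.
  move=> /cross_eq0_scale /(_ nze) [t ct].
  have {ct} cE : c = a + t *: e by rewrite -ct addrC subrK.
  have : 2%:R * bil Q a e * (t * (t + 1)) = 0.
    move: qc; rewrite cE !bil_lin (bilC e a) // qe qa => h; by apply: (lincomb1 (r := 1) h); ring.
  move/eqP; rewrite 2!mulf_eq0 (negPf two) (negPf qae) /= mulf_eq0 => t01.
  have : 2%:R * bil Q a e * ((k - t) * (k - t - 1)) = 0.
    move: qd; rewrite fk cE !bil_lin (bilC e a) // qe qa => h; by apply: (lincomb1 (r := 1) h); ring.
  move/eqP; rewrite 2!mulf_eq0 (negPf two) (negPf qae) /= mulf_eq0 => kt01.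
  case/orP: t01 => /eqP t01.
    move: kt01; rewrite t01 subr0 (negPf k0) subr_eq0 /= => /eqP k1.
    rewrite fk cE t01 k1 scale0r addr0 scale1r; rewrite qb qa; ring.
  have tE : t = -1 by apply/eqP; rewrite -subr_eq0 opprK t01.
  move: kt01; rewrite tE opprK addrK (negPf k0) orbF => /eqP k1.
  have kE : k = -1 by apply/eqP; rewrite -subr_eq0 opprK k1.
  rewrite fk cE tE kE !scaleN1r.
  have -> : - e - (a - e) = - a by rewrite opprB addKr.
  rewrite !bil_lin qa (bilC e a) // (bilC e a) // pae pa; ring.
set h := bil P e f in h0.
set t := bil P a f / h; set s := bil P c e / h.
have th : bil P a f = t * h by rewrite /t mulfVK.
have sh : bil P c e = s * h by rewrite /s mulfVK.
have hE : bil P e f = h by [].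
have fe : bil P f e = h by rewrite bilC.
have fa : bil P f a = t * h by rewrite bilC.
have ec : bil P e c = s * h by rewrite bilC.
have ea : bil P e a = 0 by rewrite bilC.
have fc : bil P f c = 0 by rewrite bilC.
have cE : c = t *: e + s *: f - a.
  apply/eqP; rewrite -subr_eq0; set y := c - _.
  have ye : bil P y e = 0 by rewrite /y !bil_lin sh pee pae fe; ring.
  have yf : bil P y f = 0 by rewrite /y !bil_lin pcf hE th pff; ring.
  (* The two orientation conditions put [y] in the plane of [e] and [f], on which [P] is
     nondegenerate since [h != 0]. *)
  have dy : triple e f y = 0.
    move: (he f) (hf e); rewrite fe hE /y !tripleE ?mxE => h1 h2; apply: (lincomb2 (q := 1) (r := -1) h1 h2); ring.
  have da : triple e f a != 0.
    rewrite -triple_rot he mulf_neq0 ?oppr_eq0 //.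
  clearbody y; have := cramer e f a y; rewrite dy scale0r addr0.
  move: (triple y f a) (triple e y a) => al be' E.
  have al0 : al = 0.
    have := congr1 (bil P f) E; rewrite !bil_lin (bilC f y) // yf fe pff mulr0 mulr0 addr0.
    by move/esym/eqP; rewrite mulf_eq0 (negPf h0) orbF => /eqP.
  have be0 : be' = 0.
    have := congr1 (bil P e) E; rewrite !bil_lin (bilC e y) // ye pee hE mulr0 mulr0 add0r.
    by move/esym/eqP; rewrite mulf_eq0 (negPf h0) orbF => /eqP.
  by move/eqP: E; rewrite al0 be0 !scale0r addr0 scaler_eq0 (negPf da).
have E1 : p + bil P a c = s * t * h by rewrite cE !bil_lin pa pae th; ring.
have E2 : p + bil P (e - a) (f - c) = (1 - s) * (1 - t) * h.
  rewrite cE !bil_lin pa pae th pee hE ea; ring.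
rewrite E1 E2.
move: qc qd qf; rewrite cE !bil_lin qe qa (bilC e a) // (bilC f a) // (bilC f e) //.
set al := bil Q a e; set be' := bil Q a f; set ga := bil Q e f; set ph := bil Q f f.
move=> q1 _ q3.
apply: (mulfI two).
apply: (lincomb2 (q := h * (1 - 2%:R * s)) (r := - (h * s ^+ 2)) q1 q3).
ring.
Qed.
End Step.

(** * The polarity attached to a conic of the pencil *)

Section Polar.
Variable F : fieldType.
Implicit Types (a b c d e f u v w x y z : 'rV[F]_3) (M N P Q : 'M[F]_3).
Hypothesis two : 2%:R != 0 :> F.

(** By Jacobi's identity, the two-by-two minors of [\adj M] are, up to sign, entries of [M] times
    [\det M]. *)
Lemma adj_rank1 M k i j : M^T = M -> \det M = 0 ->
  \adj M k k * \adj M i j = \adj M k i * \adj M k j.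
Proof.
move=> /sym_entries sM; rewrite det33 => dM.
move: k i j; apply: ord3P; apply: ord3P; apply: ord3P; rewrite !adjE !sM in dM *.
all: try by ring.
all: move: (M o0 o0) (M o0 o1) (M o0 o2) (M o1 o1) (M o1 o2) (M o2 o2) dM => m00 m01 m02 m11 m12 m22 dM.
all: (have t r s s1 := @lincomb1 _ r _ _ s s1 dM).
all: first [by apply: (t m00); ring | by apply: (t m11); ring | by apply: (t m22); ring
 | by apply: (t m01); ring | by apply: (t m02); ring | by apply: (t m12); ring
 | by apply: (t (- m01)); ring | by apply: (t (- m02)); ring | by apply: (t (- m12)); ring].
Qed.

Definition polar M Q : 'M[F]_3 :=
  2%:R *: (Q *m \adj M *m Q) - \tr (\adj M *m Q) *: Q.

Lemma bil_mxD M N x y : bil (M + N) x y = bil M x y + bil N x y.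
Proof. by rewrite /bil mulmxDr mulmxDl mxE. Qed.
Lemma bil_mxZ k M x y : bil (k *: M) x y = k * bil M x y.
Proof. by rewrite /bil -scalemxAr -scalemxAl mxE. Qed.
Lemma bil_mxN M x y : bil (- M) x y = - bil M x y.
Proof. by rewrite /bil mulmxN mulNmx mxE. Qed.

Lemma bil_adjsym N Q x y : Q^T = Q -> bil N (x *m Q) (y *m Q) = bil (Q *m N *m Q) x y.
Proof. by move=> sQ; rewrite /bil trmx_mul sQ !mulmxA. Qed.

Lemma polar_sym M Q : M^T = M -> Q^T = Q -> (polar M Q)^T = polar M Q.
Proof.
by move=> sM sQ; rewrite /polar linearB /= !linearZ /= !trmx_mul trmx_adj sM sQ mulmxA.
Qed.

(** For Q-null [u] and [v], [gram_form] becomes [Q(u, v) polar(u, v) = det Q (M(u, u) M(v, v) - M(u,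
    v)^2)]; the last factor vanishes when the line [uv] touches [M]. *)
Lemma polar_tangent M Q u v : M^T = M -> Q^T = Q ->
  bil Q u u = 0 -> bil Q v v = 0 -> bil Q u v != 0 ->
  bil M u u * bil M v v = bil M u v ^+ 2 -> bil (polar M Q) u v = 0.
Proof.
move=> sM sQ uu vv uv tg.
have sN : (\adj M)^T = \adj M by rewrite trmx_adj sM.
have := gram_form (\adj M) u v sQ.
rewrite bil_adj uu vv (bilC v u) // -expr2 tg subrr mulr0 !mul0r !subr0.
rewrite (bilC (v *m Q)) // bil_adjsym // => h.
apply: (mulfI uv); rewrite /polar bil_mxD bil_mxN !bil_mxZ.
apply: (lincomb1 (r := 1) h); ring.
Qed.

(* If [u *m polar M Q = 0] then [\det M = 0]; so if [\adj M] were nonzero it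
   would be of rank one, spanned by a kernel vector [z] of [M] which is Q-null
   and Q-orthogonal to [u], hence proportional to [u], against [bil M u u != 0]. *)
Lemma polar_eq0 M Q u : M^T = M -> Q^T = Q -> \det Q != 0 ->
  bil Q u u = 0 -> bil M u u != 0 -> u *m polar M Q = 0 -> \adj M = 0.
Proof.
move=> sM sQ dQ uu nz.
set N := \adj M; set th := \tr (N *m Q).
have uQ : Q \in unitmx by rewrite unitmxE unitfE.
have NM : N *m M = (\det M)%:M by exact: mul_adj_mx.
rewrite mulmxBr -!scalemxAr => /subr0_eq h1.
have h2 : 2%:R *: (u *m Q *m N) = th *: u.
  by rewrite -(mulmxK uQ (_ *: (_ *m N))) -scalemxAl -!mulmxA (mulmxA Q) h1 -scalemxAl mulmxK.
(* Multiplying by [M] turns [N] into [\det M]; pairing with the Q-null vector [u] then kills the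
   left side and gives [th = 0]. *)
have h3 : (2%:R * \det M) *: (u *m Q) = th *: (u *m M).
  by rewrite [RHS]scalemxAl -h2 -scalemxAl -(mulmxA _ N) NM mul_mx_scalar scalerA.
have th0 : th = 0.
  have := congr1 (bil 1%:M ^~ u) h3; rewrite !bilZl !bil1_mul uu mulr0.
  by move/esym/eqP; rewrite mulf_eq0 (negPf nz) orbF => /eqP.
have uQN : u *m Q *m N = 0.
  by apply/eqP; move/eqP: h2; rewrite th0 scale0r scaler_eq0 (negPf two).
have un0 : u != 0 by apply: contraNneq nz => ->; rewrite bil0l.
have dM : \det M = 0.
  move/eqP: h3; rewrite th0 scale0r scaler_eq0 mulf_eq0 (negPf two) /=.
  case/orP => [/eqP //|/eqP /(nondeg_eq0 dQ) u0]; by rewrite u0 eqxx in un0.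
have sN : N^T = N by rewrite trmx_adj sM.
have rk k i j : N k k * N i j = N k i * N k j.
  exact: adj_rank1.
apply/eqP/negPn/negP => Nn0.
have [k Nk] : exists k, N k k != 0.
  case: (pickP (fun k => N k k != 0)) => [k ?|h]; first by exists k.
  case/eqP: Nn0; apply/matrixP => i j; rewrite [RHS]mxE; apply/eqP.
  by rewrite -sqrf_eq0 expr2 -rk (eqP (negbFE (h i))) mul0r.
set z := row k N.
have zE i : z 0 i = N k i by rewrite mxE.
(* Rank one gives [z_i z_j = N_kk N_ij], so [Q(z, z)] is [N_kk] times the trace [th]. *)
have zQz : bil Q z z = 0.
  transitivity (N k k * th); last by rewrite th0 mulr0.
  rewrite /th trace_prod mulr_sumr /bil mxE.
  under eq_bigr => j _ do rewrite [z^T _ _]mxE [(z *m Q) _ _]mxE mulr_suml.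
  rewrite exchange_big /=; apply: eq_bigr => i _.
  rewrite mulr_sumr; apply: eq_bigr => j _.
  have -> : Q j i = Q i j by rewrite -{1}sQ mxE.
  by rewrite mulrA rk !zE mulrAC.
have uQz : bil Q u z = 0.
  by rewrite /bil /z tr_row sN colE mulmxA uQN mul0mx mxE.
have zn0 : z != 0.
  by apply: contraNneq Nk => z0; move: (congr1 (fun t : 'rV_3 => t 0 k) z0); rewrite zE [RHS]mxE => ->.
have [c uz] := cross_eq0_scale (isotropic sQ dQ uu uQz zQz) zn0.
case/eqP: nz; rewrite uz /bil -!scalemxAl /z -row_mul NM dM.
by rewrite -scalemx1 scale0r row0 mul0mx scaler0 mxE.
Qed.
End Polar.

(** * Closed chains of odd length *)

Section Cycle.
Variable F : fieldType.
Implicit Types (a b c d e f v w x y z : 'rV[F]_3) (M N : 'M[F]_3).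
Variables (P Q : 'M[F]_3) (p : F).
Hypotheses (sP : P^T = P) (sQ : Q^T = Q) (dP : \det P != 0) (dQ : \det Q != 0).
Hypotheses (p0 : p != 0) (two : 2%:R != 0 :> F).
Variables (m : nat) (u : nat -> 'rV[F]_3).
Hypotheses (su : forall i, step P Q p (u i) (u i.+1)) (pu : forall i, u (i + m.*2.+1) = u i).

Let cu i : on_curve P Q p (u i). Proof. by case: (su i). Qed.

Lemma step_repeat i j s : u i = u j -> u (i + s) = u (j + s).
Proof.
move=> e; elim: s => [|s IH]; first by rewrite !addn0.
by rewrite !addnS; apply: (step_uniq sP sQ dP dQ p0 two (su _)); rewrite IH.
Qed.

(** Negation reverses a step by [stepN], so uniqueness identifies the chain leaving [u i] with minus
    the chain read backwards from [u (i + k)]. *)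
Lemma step_reflect i k s : u i = - u (i + k) -> (s <= k)%N -> u (i + s) = - u (i + (k - s)).
Proof.
move=> e; elim: s => [|s IH] sk; first by rewrite addn0 subn0.
rewrite addnS; apply: (step_uniq sP sQ dP dQ p0 two (su _)).
rewrite IH ?(ltnW sk) //; apply: stepN.
have -> : (k - s = (k - s.+1).+1)%N by lia.
by rewrite addnS.
Qed.

Lemma opp_neq x : x != 0 -> x = - x -> False.
Proof.
move=> nz /eqP; rewrite -subr_eq0 opprK -mulr2n -scaler_nat scaler_eq0.
by rewrite (negPf two) (negPf nz).
Qed.

(* Coinciding vertices give [u i = u (i + m)], so that [u] has the periods [m]
   and [2m + 1] and is constant, or [u i = - u (i + m)], and then the chain
   is reflected in its middle vertex or side, which is absurd. *)
Lemma opposite_vertices_neq0 i : bil Q (u i) (u (i + m)) != 0.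
Proof.
have n0 j : u j != 0 := curve_neq0 p0 (cu j).
apply/negP => /eqP q0.
have [pi qi] := cu i; have [pj qj] := cu (i + m).
have [k uk] := cross_eq0_scale (isotropic sQ dQ qi q0 qj) (n0 _).
have : (k - 1) * (k + 1) * p = 0.
  by move: pi; rewrite uk !bil_lin pj => h; apply: (lincomb1 (r := 1) h); ring.
move/eqP; rewrite !mulf_eq0 (negPf p0) orbF subr_eq0 addr_eq0 => /orP[]/eqP k1.
  have e : u i = u (i + m) by rewrite uk k1 scale1r.
  have e2 : u (i + m.*2) = u (i + m.*2.+1).
    by rewrite pu -addnn addnA -(step_repeat m e) -e.
  have [pe _ _] := stepP sP p0 two (su (i + m.*2)).
  move: pe; rewrite -addnS -e2 (proj1 (cu _)) => pe.
  have : 2%:R * p = 0 by rewrite mulr_natl mulr2n {1}pe addNr.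
  by move/eqP; rewrite mulf_eq0 (negPf p0) (negPf two).
have e : u i = - u (i + m) by rewrite uk k1 scaleN1r.
have := odd_double_half m; case: (odd m) => mE.
  have := @step_reflect _ _ (m./2.+1) e; have -> : (m - m./2.+1 = m./2)%N by lia.
  have -> : (m./2.+1 <= m)%N by lia.
  move/(_ isT) => h; case: (su (i + m./2)) => _ _ + _.
  by rewrite -addnS h subrr eqxx.
have := @step_reflect _ _ (m./2) e; have -> : (m - m./2 = m./2)%N by lia.
have -> : (m./2 <= m)%N by lia.
by move/(_ isT); exact: opp_neq.
Qed.

(** [M = P + mu Q], with [mu] chosen to give the value [- p] at [i = 0]; [transport] carries it to
    all [i]. The values [p], [p], [- p] express tangency to [M]. *)
Lemma pencil_conic : exists M, [/\ M^T = M, forall i, bil M (u i) (u i) = p &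
  forall i, bil M (u i) (u (i + m)) = - p].
Proof.
set mu := - (p + bil P (u 0) (u (0 + m))) / bil Q (u 0) (u (0 + m)).
exists (P + mu *: Q); split=> [|i|i].
- by rewrite linearD linearZ /= sP sQ.
- by rewrite bil_mxD bil_mxZ; case: (cu i) => -> ->; rewrite mulr0 addr0.
suff h : p + bil P (u i) (u (i + m)) = - mu * bil Q (u i) (u (i + m)).
  rewrite bil_mxD bil_mxZ; apply: (lincomb1 (r := 1) h); ring.
elim: i => [|i IH]; first by rewrite /mu mulNr mulfVK ?opposite_vertices_neq0 ?opprK.
have := transport sP sQ dP dQ p0 two (su i) (su (i + m)).
rewrite IH -!addSn => h; apply: (mulIf (opposite_vertices_neq0 i)).
by rewrite -h; ring.
Qed.

Lemma dual_form : exists G : 'M[F]_3, [/\ G^T = G, forall i, u i *m G != 0,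
  forall i, bil G (u i) (u (i + m)) = 0 & forall i, bil G (u i) (u (i + m).+1) = 0].
Proof.
have [M [sM Mp Mm]] := pencil_conic.
have Gm i : bil (polar M Q) (u i) (u (i + m)) = 0.
  apply: polar_tangent; rewrite ?opposite_vertices_neq0 // ?(proj2 (cu _)) //.
  by rewrite Mm !Mp sqrrN expr2.
have sG := polar_sym sM sQ.
exists (polar M Q); split=> // i; last first.
  rewrite bilC //; have := Gm (i + m).+1.
  have -> : ((i + m).+1 + m = i + m.*2.+1)%N by lia.
  by rewrite pu.
apply/negP => /eqP uG.
have N0 : \adj M = 0.
  by apply: (polar_eq0 two sM sQ dQ _ _ uG); rewrite ?Mp //; case: (cu i).
(* With [\adj M = 0] all two-by-two minors of [M] vanish, so a jump by [m] negates the functional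
   [M(u j, _)]. *)
have h j x : bil M (u (j + m)) x = - bil M (u j) x.
  have := bil_adj M (u j) (u (j + m)) (u j) x.
  rewrite N0 /bil mulmx0 mul0mx mxE -!/(bil _ _ _) Mp (bilC (u (j + m)) (u j)) // Mm.
  by move=> e; apply: (mulfI p0); apply: (lincomb1 (r := -1) e); ring.
(* Two jumps by [m] from [j + 1] arrive at [u j] by periodicity, so the functional is constant as
   well. *)
have h1 j x : bil M (u j.+1) x = bil M (u j) x.
  have := h (j.+1 + m)%N x; rewrite [X in _ = - X]h opprK.
  have -> : (j.+1 + m + m = j + m.*2.+1)%N by lia.
  by rewrite pu => ->.
have h2 j x : bil M (u j) x = bil M (u 0) x.
  by elim: j => // j; rewrite h1.
have := h 0 (u 0); rewrite h2 Mp => pe.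
have : 2%:R * p = 0 by rewrite mulr_natl mulr2n {1}pe addNr.
by move/eqP; rewrite mulf_eq0 (negPf p0) (negPf two).
Qed.

End Cycle.

(** * Rescaling the vertices *)

Section Normalize.
Variable F : fieldType.
Implicit Types (a b c d e f x y z : 'rV[F]_3) (M N : 'M[F]_3).
Variables (P Q : 'M[F]_3).
Hypotheses (sP : P^T = P) (sQ : Q^T = Q) (dP : \det P != 0) (dQ : \det Q != 0).
Hypothesis two : 2%:R != 0 :> F.

(** The value forced by the Gram identity when both [P(u, u) = p] and [triple d e u = P(d, e) p] are
    required. *)
Let p := - (\det P)^-1.
Let p0 : p != 0. Proof. by rewrite oppr_eq0 invr_eq0. Qed.

Lemma bil_crossZ a b k x : bil 1%:M (k *: cross a b) x = k * triple a b x.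
Proof. exact: bilZl. Qed.

(** The two isotropic directions orthogonal to [w] are eigendirections of the cross product with
    [w], with opposite eigenvalues. The proof expands [x] in the basis [d], [e], [w]. *)
Lemma orient d e w x : bil P d d = 0 -> bil P e e = 0 -> bil P d e != 0 ->
  bil P d w = 0 -> bil P e w = 0 -> triple d e w = bil P d e * p ->
  triple w e x = - p * bil P e x /\ triple w d x = p * bil P d x.
Proof.
move=> dd ee de dw ew D.
have D0 : bil P d e * p != 0 by rewrite mulf_neq0.
have E := cramer d e w x; rewrite D in E.
move: (triple x e w) (triple d x w) (triple d e x) E => al be ga E.
have Ed := congr1 (bil P d) E; have Ee := congr1 (bil P e) E.
rewrite !bil_lin dd dw in Ed; rewrite !bil_lin ee ew (bilC e d) // in Ee.
have E1 := congr1 (bil 1%:M (cross w e)) E; have E2 := congr1 (bil 1%:M (cross w d)) E.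
rewrite !bil_lin -!/(triple _ _ _) in E1 E2.
have z1 : triple w e e = 0 by rewrite tripleE; ring.
have z2 : triple w e w = 0 by rewrite tripleE; ring.
have z3 : triple w d d = 0 by rewrite tripleE; ring.
have z4 : triple w d w = 0 by rewrite tripleE; ring.
have z5 : triple w d e = bil P d e * p by rewrite -D !tripleE; ring.
have z6 : triple w e d = - (bil P d e * p) by rewrite -D !tripleE; ring.
rewrite z1 z2 z6 in E1; rewrite z3 z4 z5 in E2.
split; apply: (mulfI D0).
  apply: (lincomb2 (q := 1) (r := p) E1 Ee); ring.
apply: (lincomb2 (q := 1) (r := - p) E2 Ed); ring.
Qed.

Section Vertex.
Variables d e v : 'rV[F]_3.
Hypotheses (dd : bil P d d = 0) (ee : bil P e e = 0) (de : bil P d e != 0).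
Hypotheses (dv : bil P d v = 0) (ev : bil P e v = 0) (v0 : v != 0).

Lemma vertex_gram : - (bil P d e ^+ 2 * bil P v v) = \det P * triple d e v ^+ 2.
Proof.
by rewrite -gram dd ee (bilC e d) // (bilC v d) // (bilC v e) // dv ev; ring.
Qed.

(** Otherwise [v] is isotropic and orthogonal to [d], hence a multiple of [d], and [P(e, v) = 0]
    makes it zero. *)
Lemma vertex_triple : triple d e v != 0.
Proof.
apply/negP => /eqP D0; have d0 : d != 0 by apply: contraNneq de => ->; rewrite bil0l.
have vv : bil P v v = 0.
  have := vertex_gram; rewrite D0 expr0n mulr0 => /eqP.
  by rewrite oppr_eq0 mulf_eq0 expf_eq0 (negPf de) /= => /eqP.
have [|k vk] := cross_eq0_scale (isotropic sP dP vv _ dd) d0; first by rewrite bilC.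
move/eqP: ev; rewrite vk bilZr (bilC e d) // mulf_eq0 (negPf de) orbF => /eqP k0.
by case/eqP: v0; rewrite vk k0 scale0r.
Qed.

Lemma vertex_norm : bil P v v != 0.
Proof.
apply/negP => /eqP vv; have /eqP := vertex_gram; rewrite vv mulr0 oppr0 eq_sym.
by rewrite mulf_eq0 (negPf dP) expf_eq0 (negPf vertex_triple).
Qed.

(** No square root is taken: [u] below is unchanged when [v], [d] or [e] is rescaled, and exchanging
    [d] and [e] changes its sign. *)
Definition vertex_scale := triple d e v / (bil P v v * bil P d e).

Lemma vertex_scale_neq0 : vertex_scale != 0.
Proof. by rewrite mulf_neq0 ?invr_neq0 ?mulf_neq0 // (vertex_triple, vertex_norm). Qed.

Let u := vertex_scale *: v.

Lemma unit_vertex : bil P u u = p.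
Proof.
have := vertex_gram; rewrite /u bilZl bilZr /vertex_scale /p => h.
apply: (mulfI dP); rewrite mulrN divff //.
have vn := vertex_norm.
apply: (mulfI (_ : bil P d e ^+ 2 * bil P v v != 0)); first by rewrite mulf_neq0 ?expf_neq0.
transitivity (\det P * triple d e v ^+ 2); last by rewrite -h mulrN1.
by field; rewrite de vn.
Qed.

Lemma unit_vertex_triple x : triple d e x = bil P d e * bil P u x.
Proof.
have := cramer d e v x => /(congr1 (bil P v)).
rewrite !bil_lin (bilC v d) // (bilC v e) // dv ev !mulr0 !add0r => h.
have vn := vertex_norm; rewrite /vertex_scale.
apply: (mulIf vn); rewrite -h; by field; rewrite de vn.
Qed.

Lemma vertex_orient x : triple u e x = - p * bil P e x /\ triple u d x = p * bil P d x.
Proof.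
apply: orient; rewrite // ?unit_vertex_triple ?unit_vertex // /u bilZr ?dv ?ev mulr0 //.
Qed.
End Vertex.

(* [d k] is the point of tangency of the side joining [v (k - 1)] and [v k]. *)
Variables (m : nat) (v d : nat -> 'rV[F]_3).
Hypotheses (pv : forall k, v (k + m.*2.+1) = v k) (pd : forall k, d (k + m.*2.+1) = d k).
Hypotheses (v0 : forall k, v k != 0) (qv : forall k, bil Q (v k) (v k) = 0).
Hypotheses (d0 : forall k, d k != 0) (dd : forall k, bil P (d k) (d k) = 0).
Hypotheses (dv : forall k, bil P (d k) (v k) = 0) (dv' : forall k, bil P (d k.+1) (v k) = 0).
Hypothesis outside : forall k, bil P (d k) (v k.+1) != 0.

(** Otherwise consecutive tangency points coincide, and [v (k + 1)] lies on the tangent at [d k]. *)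
Lemma sides_meet k : bil P (d k) (d k.+1) != 0.
Proof.
apply/negP => /eqP h; have [t dE] := cross_eq0_scale (isotropic sP dP (dd k) h (dd k.+1)) (d0 _).
by move: (outside k); rewrite dE bilZl dv mulr0 eqxx.
Qed.

Let c k := vertex_scale (d k) (d k.+1) (v k).
Let u k := c k *: v k.

(** The point [d (k + 1)] comes second at vertex [k] and first at vertex [k + 1], so its eigenvalues
    there are opposite and [u k + u (k + 1)] is a multiple of it. *)
Lemma polygon_step k : step P Q p (u k) (u k.+1).
Proof.
have on j : on_curve P Q p (u j).
  split; last by rewrite /u bilZl bilZr qv !mulr0.
  by apply: unit_vertex; rewrite ?sides_meet.
have cn j : c j != 0 by apply: vertex_scale_neq0; rewrite ?sides_meet.
have h1 x : triple (u k) (d k.+1) x = - p * bil P (d k.+1) x.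
  by have [] := vertex_orient (dd k) (dd k.+1) (sides_meet _) (dv _) (dv' _) (v0 _) x.
have h2 x : triple (u k.+1) (d k.+1) x = p * bil P (d k.+1) x.
  by have [] := vertex_orient (dd k.+1) (dd k.+2) (sides_meet _) (dv _) (dv' _) (v0 _) x.
have [|t et] := @cross_eq0_scale _ (u k + u k.+1) (d k.+1) _ (d0 _).
  by apply: cross_eq0 => x; rewrite tripleDl h1 h2 mulNr addNr.
split=> // [|x].
  apply/negP => /eqP e0; have := congr1 (bil P (d k)) e0.
  rewrite /u bilDr !bilZr dv mulr0 add0r bil0r => /eqP.
  by rewrite mulf_eq0 (negPf (cn _)) (negPf (outside _)).
by rewrite et tripleZm h1 bilZl mulrCA.
Qed.

(** [d (k + 1) *m P] is a multiple of [cross (v k) (v (k + 1))] and does not vanish on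
    [v (k + 2)]. *)
Lemma vertices_indep k : triple (v k) (v k.+1) (v k.+2) != 0.
Proof.
have h1 : bil 1%:M (d k.+1 *m P) (v k) = 0 by rewrite bil1_mul.
have h2 : bil 1%:M (d k.+1 *m P) (v k.+1) = 0 by rewrite bil1_mul.
have [|t dE] := perp_cross h1 h2.
  apply: contraNneq (outside k) => /cross_eq0_scale /(_ (v0 _)) [t vt].
  have t0 : t != 0 by apply: contraNneq (v0 k) => t0; rewrite vt t0 scale0r.
  by move/eqP: (dv k); rewrite vt bilZr mulf_eq0 (negPf t0).
move: (outside k.+1); rewrite -bil1_mul dE bil_crossZ.
by rewrite mulf_eq0 negb_or => /andP[].
Qed.

Lemma vertex_side_form : exists G : 'M[F]_3, [/\ forall x, x *m G = 0 -> x = 0,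
  forall k, bil G (v k) (v (k + m)) = 0, forall k, bil G (v k) (v (k + m).+1) = 0 &
  forall k x, bil G x (v (k + m)) = 0 -> bil G x (v (k + m).+1) = 0 ->
    exists t, x = t *: v k].
Proof.
have pu k : u (k + m.*2.+1) = u k by rewrite /u /c pv -!addSn !pd.
have [G [sG nG G1 G2]] := dual_form sP sQ dP dQ p0 two polygon_step pu.
have cn j : c j != 0 by apply: vertex_scale_neq0; rewrite ?sides_meet.
have unscale i j : bil G (u i) (u j) = 0 -> bil G (v i) (v j) = 0.
  rewrite /u bilZl bilZr; move: (c i) (c j) (cn i) (cn j) => s t s0 t0 /eqP.
  by rewrite !mulf_eq0 (negPf s0) (negPf t0) => /eqP.
have {}G1 k := unscale _ _ (G1 k); have {}G2 k := unscale _ _ (G2 k).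
have {unscale}nG k : v k *m G != 0.
  by apply: contraNneq (nG k) => h; rewrite /u -scalemxAl h scaler0.
have crn k : cross (v k) (v k.+1) != 0.
  by apply: contraNneq (vertices_indep k) => h; rewrite /triple h bil0l.
have sidek k : exists2 t, t != 0 & v k *m G = t *: cross (v (k + m)) (v (k + m).+1).
  have [||t vt] := @perp_cross _ (v (k + m)) (v (k + m).+1) (v k *m G) _ _ (crn _);
    rewrite ?bil1_mul //.
  exists t => //; apply: contraNneq (nG k) => t0; by rewrite vt t0 scale0r.
(* A kernel vector lies on every side, each being the image of its opposite vertex. The first two
   sides used meet in [v 1], which is not on the third. *)
have inj x : x *m G = 0 -> x = 0.
  move=> xG.
  have h k : triple (v k) (v k.+1) x = 0.
    have [t t0 vt] := sidek (k + m.+1)%N.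
    have e : (k + m.+1 + m = k + m.*2.+1)%N by lia.
    move: vt; rewrite e -addSn !pv => vt.
    have : t * triple (v k) (v k.+1) x = 0.
      by rewrite -bil_crossZ -vt bil1_mul bilC // -bil1_mul xG bil0l.
    by move/eqP; rewrite mulf_eq0 (negPf t0) => /eqP.
  have := cramer (v 0) (v 1) (v 2) x; rewrite (h 0).
  have -> : triple x (v 1) (v 2) = 0 by rewrite triple_rot h.
  rewrite !scale0r add0r addr0; move: (triple (v 0) x (v 2)) => t xt.
  have := h 2; have := congr1 (bil 1%:M (cross (v 2) (v 3))) xt.
  rewrite !bilZr -!/(triple _ _ _) => + h0; rewrite h0 mulr0 -triple_rot => /esym/eqP.
  rewrite mulf_eq0 (negPf (vertices_indep _)) orbF => /eqP t0.
  by move/eqP: xt; rewrite t0 scale0r scaler_eq0 (negPf (vertices_indep 0)) => /eqP.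
exists G; split=> // k x x1 x2.
have [||s xs] := @perp_cross _ (v (k + m)) (v (k + m).+1) (x *m G) _ _ (crn _);
  rewrite ?bil1_mul //.
have [t t0 vt] := sidek k; exists (s / t); apply/subr0_eq/inj.
by rewrite mulmxBl -scalemxAl xs vt scalerA mulfVK // subrr.
Qed.

End Normalize.

(** * Polygons *)

Section Generator.
Variables (K : fieldType) (V : vectType K).

Definition generator (q : proj V) : V := vpick q.

Lemma generator_neq0 (q : proj V) : generator q != 0.
Proof. by rewrite vpick0 -dimv_eq0 proj_dim. Qed.

Lemma generator_span (q : proj V) : q = <[generator q]>%VS :> {vspace V}.
Proof.
apply/esym/eqP; rewrite eqEdim -memvE memv_pick /= dim_vline generator_neq0.
by rewrite proj_dim.
Qed.

Lemma generator_mem (q : proj V) : generator q \in (q : {vspace V}).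
Proof. exact: memv_pick. Qed.
End Generator.

(** * Polarities as projective isomorphisms onto the dual plane *)

Section Form.
Variable K : fieldType.

Definition form (G : 'M[K]_3) (x y : 'rV[K]_3) : K^o := bil G x y.

Fact form_is_linear G x : linear (form G x).
Proof. by move=> k y z; rewrite /form bilDr bilZr. Qed.
HB.instance Definition _ G x :=
  GRing.isLinear.Build K 'rV[K]_3 K^o _ (form G x) (form_is_linear G x).

Definition polarity (G : 'M[K]_3) (x : 'rV[K]_3) : dual 'rV[K]_3 := linfun (form G x).

Lemma polarityE G x y : polarity G x y = bil G x y.
Proof. exact: lfunE. Qed.

Fact polarity_is_linear G : linear (polarity G).
Proof.
move=> k x y; apply/lfunP => z; rewrite add_lfunE scale_lfunE !polarityE.
by rewrite bilDl bilZl.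
Qed.
HB.instance Definition _ G :=
  GRing.isLinear.Build K 'rV[K]_3 (dual 'rV[K]_3) _ (polarity G) (polarity_is_linear G).

Variable G : 'M[K]_3.
Hypothesis injG : forall x : 'rV[K]_3, x *m G = 0 -> x = 0.

Definition polarity_hom : 'Hom('rV[K]_3, dual 'rV[K]_3) := linfun (polarity G).

Lemma polarity_ker : lker polarity_hom = 0%VS.
Proof.
apply/eqP; rewrite -subv0; apply/subvP => x; rewrite memv_ker lfunE /= => /eqP h.
rewrite memv0; apply/eqP/injG/bil_eq0 => y.
by rewrite -polarityE h zero_lfunE.
Qed.

Lemma polarity_img : limg polarity_hom = fullv.
Proof.
apply/eqP; rewrite eqEdim subvf /= limg_dim_eq ?polarity_ker ?capv0 //.
Qed.

Fact polarity_proj_dim (q : proj 'rV[K]_3) : \dim (polarity_hom @: q)%VS = 1%N.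
Proof. by rewrite limg_dim_eq ?polarity_ker ?capv0 // proj_dim. Qed.

Definition polarity_proj q := Proj (polarity_proj_dim q).

Lemma polarity_proj_iso : is_proj_iso polarity_proj.
Proof. by exists polarity_hom; rewrite polarity_ker polarity_img. Qed.

(** By surjectivity a form vanishing on the line is [G(x, _)] for some [x], which the last
    hypothesis makes a multiple of the generator of [q]. *)
Lemma polarity_annihilator (q r s : proj 'rV[K]_3) :
  bil G (generator q) (generator r) = 0 -> bil G (generator q) (generator s) = 0 ->
  (forall x, bil G x (generator r) = 0 -> bil G x (generator s) = 0 ->
     exists t, x = t *: generator q) ->
  polarity_proj q = annihilator (join r s) :> {vspace _}.
Proof.
move=> qr qs uq; rewrite /= {1}generator_span limg_line; apply/eqP.
rewrite eqEsubv -memvE; apply/andP; split.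
  apply/mem_annihilatorP => w /memv_addP [w1 + [w2 + ->]].
  rewrite !generator_span => /vlineP [a ->] /vlineP [b ->].
  by rewrite lfunE polarityE bilDr !bilZr qr qs !mulr0 addr0.
apply/subvP => f /mem_annihilatorP fz.
have : f \in limg polarity_hom by rewrite polarity_img memvf.
case/memv_imgP => x _ fx.
have fE y : bil G x y = f y by rewrite fx lfunE polarityE.
have [||t xt] := uq x; rewrite ?fE ?fz //.
- by rewrite (subvP (addvSl _ _)) ?generator_mem.
- by rewrite (subvP (addvSr _ _)) ?generator_mem.
by rewrite fx xt linearZ memvZ // memv_line.
Qed.

End Form.

(** * Parity and periodicity of residues modulo 2n *)

Section Indices.
Variable n : nat.
Hypothesis on : odd n.

Lemma odd_index k : odd (k%:R : 'Z_(n.*2)) = odd k.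
Proof.
rewrite val_Zp_nat; last by case: n on => //= ? _; lia.
by rewrite odd_mod ?odd_double.
Qed.

Lemma index_period k : (k + n.*2)%:R = k%:R :> 'Z_(n.*2).
Proof.
by rewrite natrD (_ : n.*2%:R = 0) ?addr0 // pchar_Zp //; case: n on => //= ? _; lia.
Qed.
End Indices.

Theorem proposition7 (R : realType) (n : nat) (A : polygon R n) :
  odd n -> nondegenerate_polygon A -> poncelet A -> n_self_dual A.
Proof.
move=> on ndA [[Q [sQ dQ] inA] [P [sP dP] ciA]].
have nE : n = (n./2).*2.+1 by rewrite -[LHS]odd_double_half on.
have tangency (j : 'Z_(n.*2)) : exists dj, ~~ odd j ->
    [/\ dj != 0, bil P dj dj = 0, is_line (side A j) &
        forall w, w \in side A j <-> bil P dj w = 0].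
  (* The value 0 at odd [j] is a dummy that lets choice range over all residues. *)
  have [|oj] := boolP (odd j); first by exists 0.
  have [lj [q [cq tq]]] := ciA j oj; exists (generator q) => _; split=> //.
  - exact: generator_neq0.
  - by rewrite /bil cq ?generator_mem // mxE.
  move=> w; rewrite tq; split=> [h|h x]; first by rewrite /bil h ?generator_mem ?mxE.
  rewrite generator_span => /vlineP [k ->].
  apply/matrixP => a b; rewrite !ord1 -scalemxAl -scalemxAl mxE -/(bil _ _ _) h.
  by rewrite mulr0 mxE.
have [d dS] := choice tangency.
(* Natural indices: [v k] spans vertex [2k + 1], and [e k] is the tangency point of side [2k], which
   joins [v (k - 1)] and [v k]. *)
pose v k := generator (A k.*2.+1%:R); pose e k := d k.*2%:R.
have oddi k : odd (k.*2.+1%:R : 'Z_(n.*2)) by rewrite odd_index //= odd_double.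
have eveni k : ~~ odd (k.*2%:R : 'Z_(n.*2)) by rewrite odd_index //= odd_double.
have sideE k : side A k.+1.*2%:R = join (A k.*2.+1%:R) (A k.+1.*2.+1%:R).
  rewrite /side; congr (join (A _) (A _)); last by rewrite natr1.
  by rewrite doubleS -[k.*2.+2%:R]natr1 addrK.
have per k : (k + n./2.*2.+1).*2%:R = k.*2%:R :> 'Z_(n.*2).
  by rewrite -nE doubleD index_period.
have pv k : v (k + n./2.*2.+1)%N = v k.
  by rewrite /v -natr1 per natr1.
have pe k : e (k + n./2.*2.+1)%N = e k by rewrite /e per.
have v0 k : v k != 0 by exact: generator_neq0.
have qv k : bil Q (v k) (v k) = 0 by rewrite /bil (inA _ (oddi k)) ?generator_mem ?mxE.
have e0 k : e k != 0 by have [] := dS _ (eveni k).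
have ee k : bil P (e k) (e k) = 0 by have [] := dS _ (eveni k).
have ev' k : bil P (e k.+1) (v k) = 0.
  have [_ _ _ h] := dS _ (eveni k.+1); apply/h.
  by rewrite sideE (subvP (addvSl _ _)) ?generator_mem.
have ev k : bil P (e k) (v k) = 0.
  (* Shifting by a period makes the index a successor, so [k = 0] needs no predecessor. *)
  rewrite -pe -pv addnS; have [_ _ _ h] := dS _ (eveni (k + n./2.*2).+1); apply/h.
  by rewrite sideE (subvP (addvSr _ _)) ?generator_mem.
have gn k : bil P (e k) (v k.+1) != 0.
  (* If it vanished, side [2k] would contain three consecutive vertices. *)
  have [_ _ ln h] := dS _ (eveni k); apply/negP => /eqP /h wL.
  apply: (ndA k.*2.+1%:R (oddi k)); exists (side A k.*2%:R) => //.
  have s1 : k.*2.+1%:R - 2%:R = k.*2%:R - 1 :> 'Z_(n.*2) by rewrite -natr1; ring.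
  have s2 : k.*2.+1%:R + 2%:R = k.+1.*2.+1%:R :> 'Z_(n.*2).
    by rewrite -natrD addn2 doubleS.
  split; first by rewrite s1 addvSl.
    by rewrite -natr1 addvSr.
  by rewrite s2 generator_span -memvE.
have two : 2%:R != 0 :> R[i] by rewrite Num.Theory.pnatr_eq0.
have [G [Ginj G1 G2 G3]] := vertex_side_form sP sQ dP dQ two pv pe v0 qv e0 ee ev ev' gn.
exists (polarity_proj Ginj); first exact: polarity_proj_iso.
move=> i oi; set k := (i : nat)./2.
have iE : i = k.*2.+1%:R.
  by rewrite -[LHS]natr_Zp; congr (_%:R); rewrite -[LHS]odd_double_half oi.
(* With [n = 2m + 1], the side opposite to vertex [2k + 1] has index [2(k + m + 1)] and joins
   [v (k + m)] and [v (k + m + 1)]. *)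
have -> : i + n%:R = (k + n./2).+1.*2%:R.
  by rewrite iE -natrD; congr (_%:R); rewrite [in LHS]nE; lia.
rewrite sideE iE; apply: polarity_annihilator; [exact: G1 | exact: G2 | exact: G3].
Qed.
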